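(* The approximation problem $\mathrm{APP}=\{\mathrm{APP}_s\}_{s\in\mathbb N}$ is QPT if and only if $m_0=1$. If $m_0=1$, then the exponent of QPT satisfies $$t^*\le\frac{2}{a_1\,\log\omega^{-1}},$$ and this bound becomes an equality for constant $\boldsymbol a$ and $\boldsymbol b$ (i.e. $a_j=a_1$ and $b_j=b_1$ for all $j\in\mathbb N$).
   Context: Notation: $\mathbb N=\{1,2,\dots\}$, $\mathbb N_0=\{0,1,2,\dots\}$; $\log$ is the natural logarithm. Setting. $H$ is an infinite-dimensional separable Hilbert space over $\mathbb R$ or $\mathbb C$ with orthonormal basis $\{e_k\}_{k\in\mathbb N_0}$; $\omega\in(0,1)$; $\boldsymbol m=\{m_k\}_{k\in\mathbb N_0}$ is a bounded sequence of positive integers; $r_0=0$ and $r_k=m_0+\cdots+m_{k-1}$ for $k\ge1$. For $n\in\mathbb N_0$ let $k(n)$ be the unique $k\in\mathbb N_0$ with $r_k\le n\le r_{k+1}-1$. For $a,b>0$ let $$H_{a,b}=\Big\{f\in H:\ \|f\|_{H_{a,b}}:=\Big(\sum_{k=0}^\infty\omega^{-ak^b}\sum_{j=r_k}^{r_{k+1}-1}|\langle f,e_j\rangle_H|^2\Big)^{1/2}<\infty\Big\}.$$ The sequences $\boldsymbol a=\{a_j\}_{j\in\mathbb N}$, $\boldsymbol b=\{b_j\}_{j\in\mathbb N}$ consist of positive reals with $0<a_1\le a_2\le\cdots$ and $\inf_jb_j>0$. Let $H_s=H\otimes\cdots\otimes H$ ($s$-fold Hilbert tensor product) with orthonormal basis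 $e_{\boldsymbol n}=e_{n_1}\otimes\cdots\otimes e_{n_s}$, $\boldsymbol n\in\mathbb N_0^s$, and $H_{s,\boldsymbol a,\boldsymbol b}=H_{a_1,b_1}\otimes\cdots\otimes H_{a_s,b_s}$; equivalently, $H_{s,\boldsymbol a,\boldsymbol b}$ is the set of $f\in H_s$ with $\|f\|_{H_{s,\boldsymbol a,\boldsymbol b}}^2=\sum_{\boldsymbol n\in\mathbb N_0^s}\omega^{-\sum_{j=1}^sa_j[k(n_j)]^{b_j}}|\langle f,e_{\boldsymbol n}\rangle_{H_s}|^2<\infty$. The operator $\mathrm{APP}_s:H_{s,\boldsymbol a,\boldsymbol b}\to H_s$ is the embedding $\mathrm{APP}_sf=f$. Information complexity. For $n\in\mathbb N_0$, $e(n,\mathrm{APP}_s)=\inf_{A_n}\sup_{\|f\|_{H_{s,\boldsymbol a,\boldsymbol b}}\le1}\|f-A_nf\|_{H_s}$, the infimum being over all algorithms $A_nf=\sum_{j=1}^nL_j(f)g_j$ with continuous linear functionals $L_j$ on $H_{s,\boldsymbol a,\boldsymbol b}$ and $g_j\in H_s$ ($A_0=0$). For $\varepsilon>0$, $n(\varepsilon,\mathrm{APP}_s)=\min\{n\in\mathbb N_0:\ e(n,\mathrm{APP}_s)\le\varepsilon\}$. QPT (quasi-polynomial tractability) means that there are positive numbers $C,t$ such that $$n(\varepsilon,\mathrm{APP}_s)\le C\exp\big(t(1+\log s)(1+\log\varepsilon^{-1})\big)\quad\text{for all } s\in\mathbb N,\ \varepsilon\in(0,1).$$ The infimum of the $t$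 for which such a bound holds (for some $C$) is denoted $t^*$ and called the exponent of QPT. *)

(* Defs.v *)
From HB Require Import structures.
From mathcomp Require Import all_boot all_order all_algebra.
From mathcomp Require Import complex.
From mathcomp Require Import all_classical all_reals all_analysis.

Set Implicit Arguments.
Unset Strict Implicit.
Unset Printing Implicit Defensive.

Import Order.TTheory GRing.Theory Num.Theory.
Import numFieldNormedType.Exports.

Local Open Scope classical_set_scope.
Local Open Scope ring_scope.

Variant scalar_kind := real_scalars | complex_scalars.

Definition scalars (R : realType) (F : scalar_kind) : numFieldType :=
  match F with real_scalars => R | complex_scalars => (R[i])%C end.

Definition sconj (R : realType) (F : scalar_kind) :
    scalars R F -> scalars R F :=
  match F with real_scalars => idfun | complex_scalars => Num.conj end.

Definition sre (R : realType) (F : scalar_kind) : scalars R F -> R :=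
  match F with real_scalars => idfun | complex_scalars => @complex.Re R end.

(* The inner product is linear in its first argument.  MathComp norms take
   their values in the field of scalars, hence the equation [hilbert_normE]
   in [scalars R F] and the use of [sre] below to get real numbers. *)
Record hilbert (R : realType) (F : scalar_kind) := Hilbert {
  hilbert_space :> completeNormedModType (scalars R F) ;
  dot : {dot hilbert_space for @sconj R F} ;
  hilbert_normE : forall x : hilbert_space, `|x| ^+ 2 = dot x x }.
Arguments dot {R F} h.

Definition sabs (R : realType) (F : scalar_kind) (z : scalars R F) : R :=
  sre `|z|.

Definition hnorm (R : realType) (F : scalar_kind) (X : hilbert R F) (x : X) : R :=
  sre `|x|.

Section HilbertNotions.
Variables (R : realType) (F : scalar_kind).
Implicit Types X : hilbert R F.

Definition linear_span X (S : set X) : set X :=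
  [set x | exists n (c : 'I_n -> scalars R F) (v : 'I_n -> X),
     (forall i, S (v i)) /\ x = \sum_(i < n) c i *: v i].

Definition orthonormal_basis X (I : eqType) (e : I -> X) : Prop :=
  (forall i j, dot X (e i) (e j) = (i == j)%:R) /\
  closure (linear_span (range e)) = setT.

(* [tau] exhibits [Xs] as the [s]-fold Hilbert tensor product of [X]:
   [tau f] is the elementary tensor f_1 (x) ... (x) f_s.  This determines
   [(Xs, tau)] up to a unique isometric isomorphism. *)
Record hilbert_tensor (X Xs : hilbert R F) (s : nat) (tau : ('I_s -> X) -> Xs) : Prop := {
  tensor_multilinear : forall (i : 'I_s) (f : 'I_s -> X) (c : scalars R F) (x y : X),
    tau (fun j => if j == i then c *: x + y else f j) =
    c *: tau (fun j => if j == i then x else f j) +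
    tau (fun j => if j == i then y else f j) ;
  tensor_dot : forall f g : 'I_s -> X,
    dot Xs (tau f) (tau g) = \prod_(j < s) dot X (f j) (g j) ;
  tensor_dense : closure (linear_span (range tau)) = setT }.

Section WeightedSpace.
Variables (X : hilbert R F) (I : choiceType) (E : I -> X) (w : I -> R).

Definition wsqnorm (f : X) : \bar R :=
  \esum_(i in [set: I]) (w i * sabs (dot X f (E i)) ^+ 2)%:E.

Definition wspace : set X := [set f | (wsqnorm f < +oo)%E].

Definition wnorm (f : X) : R := Num.sqrt (fine (wsqnorm f)).

(* Continuous linear functionals on [wspace] normed by [wnorm]; the values of
   [L] outside the subspace [wspace] are irrelevant. *)
Definition continuous_functional (L : X -> scalars R F) : Prop :=
  (forall c f g, wspace f -> wspace g -> L (c *: f + g) = c * L f + L g) /\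
  (forall f, wspace f -> forall eps : R, 0 < eps ->
     exists2 delta : R, 0 < delta & forall g, wspace g ->
       wnorm (g - f) < delta -> sabs (L g - L f) < eps).

Definition algorithm (n : nat) : set (X -> X) :=
  [set A | exists (L : 'I_n -> X -> scalars R F) (g : 'I_n -> X),
     (forall j, continuous_functional (L j)) /\
     (forall f, wspace f -> A f = \sum_(j < n) L j f *: g j)].

Definition minimal_error (n : nat) : \bar R :=
  ereal_inf [set ereal_sup [set (hnorm (f - A f))%:E
                           | f in [set f | wspace f /\ wnorm f <= 1]]
            | A in algorithm n].

(* [+oo] when no [n] qualifies. *)
Definition information_complexity (eps : R) : \bar R :=
  if pselect (exists n, (minimal_error n <= eps%:E)%E) is left h
  then (ex_minn h)%:R%:E else +oo%E.

End WeightedSpace.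

(* The sequences a_1, a_2, ... and b_1, b_2, ... are indexed from 0 here:
   [a j] stands for a_{j+1}. *)
Section Approximation.
Variables (m : nat -> nat) (omega : R) (a b : nat -> R).

Definition block_start (k : nat) : nat := (\sum_(i < k) m i)%N.

(* k(n); the default value 0 is never used when all [m i] are positive. *)
Definition block_index (n : nat) : nat :=
  xget 0%N [set k | (block_start k <= n <= (block_start k.+1).-1)%N].

Definition app_weight (s : nat) (n : {ffun 'I_s -> nat}) : R :=
  omega `^ (- \sum_(j < s) a j * (block_index (n j))%:R `^ b j).

Definition tensor_basis (H : hilbert R F) (e : nat -> H) (s : nat)
    (Hs : hilbert R F) (tau : ('I_s -> H) -> Hs) (n : {ffun 'I_s -> nat}) : Hs :=
  tau (fun j => e (n j)).

Definition app_complexity (H : hilbert R F) (e : nat -> H)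
    (Hs : nat -> hilbert R F) (tau : forall s, ('I_s -> H) -> Hs s)
    (s : nat) (eps : R) : \bar R :=
  information_complexity (tensor_basis e (@tau s)) (@app_weight s) eps.

End Approximation.

End HilbertNotions.

Section QPT.
Variables (R : realType) (nc : nat -> R -> \bar R).

Definition qpt_bound (t : R) : Prop :=
  exists2 C : R, 0 < C & forall (s : nat) (eps : R),
    (0 < s)%N -> 0 < eps < 1 ->
    (nc s eps <= (C * expR (t * (1 + ln s%:R) * (1 + ln eps^-1)))%:E)%E.

Definition QPT : Prop := exists2 t : R, 0 < t & qpt_bound t.

Definition qpt_exponent : \bar R :=
  ereal_inf [set t%:E | t in [set t : R | 0 < t /\ qpt_bound t]].

End QPT.

(* Main.v *)
(** The complexity of approximating the embedding of a weighted space into a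
    Hilbert space with orthonormal basis [E] is the number of basis vectors
    whose weight is less than [eps^-2]: projecting onto their span is an
    algorithm with error at most [eps], and any algorithm with fewer
    functionals annihilates a nonzero vector of this span.

    Let [k(n)] be the block index of [n] and [L = ln (1 / omega)].  If
    [m 0 = 1], then [k(n) >= 1] for [n >= 1], and counting the multi-indices
    by Markov's inequality with an exponent proportional to [1 + ln s] makes
    every coordinate contribute a factor at most [1 + D / s]; the product is at
    most [e^D], which yields the bound with [t = 2 / (a 0 * L)].  Conversely,
    the multi-indices with [d] entries 1 and all others 0 number
    [binomial s d], of order [s^d].  If [m 0 > 1] they have weight 1, and [d]
    is unbounded for fixed [eps], so quasi-polynomial tractability fails.  If
    [m 0 = 1] and [a] is constant, they have weight [expR (L * a 0 * d)], and
    letting first [s] and then [d] tend to infinity forces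
    [t >= 2 / (a 0 * L)]. *)
Require Import Defs.
From HB Require Import structures.
From mathcomp Require Import all_boot all_order all_algebra.
From mathcomp Require Import complex.
From mathcomp Require Import all_classical all_reals all_analysis.
From mathcomp Require Import ring lra zify.
Import Order.TTheory GRing.Theory Num.Theory.
Import numFieldNormedType.Exports.
Local Open Scope classical_set_scope.
Local Open Scope ring_scope.

Set Implicit Arguments.
Unset Strict Implicit.
Unset Printing Implicit Defensive.

(** * Real numbers inside the scalar field *)

Section Scalars.
Variables (R : realType) (F : scalar_kind).
Implicit Types (x y r : R) (z : scalars R F).

(** Norm identities are proved in [scalars R F] and brought back to [R] by the injectivity of this
    inclusion. *)
Definition sreal (F : scalar_kind) : R -> scalars R F :=
  match F with real_scalars => idfun | complex_scalars => real_complex R end.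

Lemma sre_sreal r : sre (sreal F r) = r.
Proof. by case: F. Qed.

Lemma sreal_inj : injective (sreal F).
Proof. exact: can_inj sre_sreal. Qed.

Lemma sreal0 : sreal F 0 = 0.
Proof. by case: F. Qed.

Lemma sreal1 : sreal F 1 = 1.
Proof. by case: F. Qed.

Lemma srealD : {morph sreal F : x y / x + y}.
Proof. by case: F => x y //=; rewrite rmorphD. Qed.

Lemma srealM : {morph sreal F : x y / x * y}.
Proof. by case: F => x y //=; rewrite rmorphM. Qed.

Lemma srealX n : {morph sreal F : x / x ^+ n}.
Proof. by case: F => x //=; rewrite rmorphXn. Qed.

Lemma sreal_le x y : (sreal F x <= sreal F y) = (x <= y).
Proof. by case: F => //=; rewrite lecR. Qed.

Lemma sreal_lt x y : (sreal F x < sreal F y) = (x < y).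
Proof. by case: F => //=; rewrite ltcR. Qed.

Lemma ge0_sreal z : 0 <= z -> z = sreal F (sre z).
Proof. by case: F z => //= z z0; rewrite RRe_real// ger0_real. Qed.

Lemma normr_sreal z : `|z| = sreal F (sabs z).
Proof. by rewrite -ge0_sreal. Qed.

Lemma mul_sconj z : z * sconj z = sreal F (sabs z ^+ 2).
Proof.
rewrite srealX -normr_sreal.
case: F z => /= z; last by rewrite normCK.
by rewrite real_normK// num_real.
Qed.

Lemma sabs_ge0 z : 0 <= sabs z.
Proof. by rewrite -sreal_le sreal0 -normr_sreal. Qed.

Lemma sabs0 : sabs (0 : scalars R F) = 0.
Proof. by apply: sreal_inj; rewrite -normr_sreal normr0 sreal0. Qed.

Lemma sabs_sreal r : 0 <= r -> sabs (sreal F r) = r.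
Proof.
move=> r0; apply: sreal_inj; rewrite -normr_sreal ger0_norm//.
by rewrite -sreal0 sreal_le.
Qed.

Lemma sconj0 : sconj (0 : scalars R F) = 0.
Proof. by case: F => //=; rewrite rmorph0. Qed.

End Scalars.

(** * Real-valued norms and inner products *)

Section Hilbert.
Variables (R : realType) (F : scalar_kind) (X : hilbert R F).
Implicit Types (x y : X) (c : scalars R F).

Lemma normr_hnorm x : `|x| = sreal F (hnorm x).
Proof. by rewrite -ge0_sreal. Qed.

Lemma dotxx x : dot X x x = sreal F (hnorm x ^+ 2).
Proof. by rewrite srealX -normr_hnorm hilbert_normE. Qed.

Lemma hnorm_ge0 x : 0 <= hnorm x.
Proof. by rewrite -(sreal_le F) sreal0 -normr_hnorm. Qed.

Lemma hnorm_eq0 x : (hnorm x == 0) = (x == 0).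
Proof. by rewrite -(inj_eq (@sreal_inj _ F)) -normr_hnorm sreal0 normr_eq0. Qed.

Lemma hnorm_add x y : hnorm (x + y) <= hnorm x + hnorm y.
Proof. by rewrite -(sreal_le F) srealD -!normr_hnorm ler_normD. Qed.

Lemma hnorm_scale c x : hnorm (c *: x) = sabs c * hnorm x.
Proof.
by apply: (@sreal_inj _ F); rewrite srealM -normr_sreal -!normr_hnorm normrZ.
Qed.

Lemma dot_sym x y : dot X x y = sconj (dot X y x).
Proof. by rewrite hermitian_subproof expr0 mul1r. Qed.

Lemma dotDl x y z : dot X (x + y) z = dot X x z + dot X y z.
Proof. exact: linearDl. Qed.

Lemma dotBl x y z : dot X (x - y) z = dot X x z - dot X y z.
Proof. exact: linearBl. Qed.

Lemma dotZl c x z : dot X (c *: x) z = c * dot X x z.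
Proof. exact: linearZl_LR. Qed.

Lemma dot_suml I (S : seq I) (f : I -> X) z :
  dot X (\sum_(i <- S) f i) z = \sum_(i <- S) dot X (f i) z.
Proof. exact: linear_sumlz. Qed.

Lemma dotDr x y z : dot X z (x + y) = dot X z x + dot X z y.
Proof. exact: linearDr. Qed.

Lemma dotZr c x z : dot X z (c *: x) = sconj c * dot X z x.
Proof. exact: linearZr_LR. Qed.

(** Balls have radii in [scalars R F]; a positive radius there is real, so real radii suffice. *)
Lemma closure_hnormP (A : set X) x :
  closure A x <-> forall r : R, 0 < r -> exists2 y, A y & hnorm (x - y) < r.
Proof.
split=> [Ax r r0|Ax B /nbhs_ballP[r /= r0 Br]].
  have sr0 : 0 < sreal F r by rewrite -sreal0 sreal_lt.
  have [y [Ay]] := Ax _ (nbhsx_ballx x _ sr0).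
  rewrite -ball_normE /= normr_hnorm sreal_lt => xy.
  by exists y.
have rE : r = sreal F (sre r) by apply: ge0_sreal; exact: ltW.
have [|y Ay xy] := Ax (sre r); first by rewrite -(sreal_lt F) sreal0 -rE.
exists y; split => //; apply: Br.
by rewrite -ball_normE /= normr_hnorm rE sreal_lt.
Qed.

End Hilbert.

(** * Projections onto finite orthonormal families *)

Section Projection.
Variables (R : realType) (F : scalar_kind) (X : hilbert R F).
Variables (I : eqType) (E : I -> X).
Hypothesis orthoE : forall i j, dot X (E i) (E j) = (i == j)%:R.
Implicit Types (x y g : X) (S : seq I).

Definition oproj S x := \sum_(i <- S) dot X x (E i) *: E i.

Lemma pythagoras S g (d : I -> scalars R F) : uniq S ->
  (forall i, i \in S -> dot X g (E i) = 0) ->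
  hnorm (g + \sum_(i <- S) d i *: E i) ^+ 2 =
  hnorm g ^+ 2 + \sum_(i <- S) sabs (d i) ^+ 2.
Proof.
elim: S => [|i S IH]; first by rewrite !big_nil !addr0.
move=> /= /andP[iS uS] gS; rewrite !big_cons [in LHS]addrCA addrC.
(* [u] is [g] plus the terms of the tail; it is orthogonal to [E i] because [i] does not recur in
   the tail. *)
set u := g + _.
have u0 : dot X u (E i) = 0.
  rewrite dotDl gS ?mem_head// dot_suml big_seq big1 ?addr0// => j jS.
  rewrite dotZl orthoE; case: eqVneq => [ji|_]; last by rewrite mulr0.
  by rewrite -ji jS in iS.
apply: (@sreal_inj _ F); rewrite addrCA -IH//; last first.
  by move=> j jS; apply: gS; rewrite inE jS orbT.
rewrite -/u -dotxx srealD -(dotxx u); move: u u0 => {IH} u u0.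
rewrite dotDl !dotDr !dotZl !dotZr.
rewrite u0 orthoE eqxx mulr0 addr0 (dot_sym (E i)) u0 sconj0 mulr0 add0r mulr1.
by rewrite mul_sconj addrC.
Qed.

Lemma dot_proj S x i : uniq S -> i \in S -> dot X (x - oproj S x) (E i) = 0.
Proof.
move=> uS iS; rewrite dotBl dot_suml (bigD1_seq i)//= big1 ?addr0.
  by rewrite dotZl orthoE eqxx mulr1 subrr.
by move=> j ji; rewrite dotZl orthoE (negbTE ji) mulr0.
Qed.

Lemma hnorm_proj S x : uniq S ->
  hnorm x ^+ 2 = hnorm (x - oproj S x) ^+ 2 + \sum_(i <- S) sabs (dot X x (E i)) ^+ 2.
Proof.
move=> uS; rewrite -pythagoras//; first by rewrite -/(oproj S x) subrK.
by move=> i; exact: dot_proj.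
Qed.

Lemma hnorm_projB S x : uniq S -> hnorm (x - oproj S x) <= hnorm x.
Proof.
move=> uS; rewrite -(@ler_pXn2r _ 2) ?nnegrE ?hnorm_ge0// [leRHS](hnorm_proj x uS).
by rewrite lerDl sumr_ge0// => i _; rewrite sqr_ge0.
Qed.

Lemma projB S x y : oproj S (x - y) = oproj S x - oproj S y.
Proof.
by rewrite -sumrB; apply: eq_bigr => i _; rewrite dotBl scalerBl.
Qed.

(** The map [k] may repeat indices, so arbitrary linear combinations of basis vectors are
    covered. *)
Lemma proj_span (J : eqType) (r : seq J) (c : J -> scalars R F) (k : J -> I) S :
  uniq S -> (forall j, j \in r -> k j \in S) ->
  oproj S (\sum_(j <- r) c j *: E (k j)) = \sum_(j <- r) c j *: E (k j).
Proof.
move=> uS kS; rewrite /oproj.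
under eq_bigr do rewrite dot_suml scaler_suml.
rewrite exchange_big /= [LHS]big_seq [RHS]big_seq; apply: eq_bigr => j /kS jS.
rewrite (bigD1_seq (k j))//= big1 ?addr0 => [|i ik].
  by rewrite dotZl orthoE eqxx mulr1.
by rewrite dotZl orthoE eq_sym (negbTE ik) mulr0 scale0r.
Qed.

(** Since P_S P_T = P_T, the residual x - P_S x is the contraction I - P_S applied to x - P_T x. *)
Lemma hnorm_proj_sub S T x : uniq S -> {subset T <= S} ->
  hnorm (x - oproj S x) <= hnorm (x - oproj T x).
Proof.
move=> uS TS; have -> : x - oproj S x = x - oproj T x - oproj S (x - oproj T x).
  by rewrite projB [oproj S (oproj T x)]proj_span// opprB addrA subrK.
exact: hnorm_projB.
Qed.

(** If y is a finite combination close to x and S its set of indices, P_S fixes y, so x - P_S x = (I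
    - P_S)(x - y). *)
Lemma proj_dense x r : closure (linear_span (range E)) x -> 0 < r ->
  exists2 S, uniq S & hnorm (x - oproj S x) < r.
Proof.
move=> /closure_hnormP xE r0; have [_ [n [c [v [vE ->]]]] xy] := xE _ r0.
have /choice[k kv] : forall j, exists i, E i = v j.
  by move=> j; have [i _ <-] := vE j; exists i.
exists (undup [seq k j | j <- enum 'I_n]); first exact: undup_uniq.
apply: le_lt_trans xy; set y := \sum_(_ < _) _; set S := undup _.
have yS : oproj S y = y.
  have -> : y = \sum_(j < n) c j *: E (k j) by apply: eq_bigr => j _; rewrite kv.
  apply: proj_span; first exact: undup_uniq.
  by move=> j _; rewrite mem_undup map_f ?mem_enum.
have -> : x - oproj S x = (x - y) - oproj S (x - y).
  by rewrite projB yS opprB addrA subrK.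
by apply: hnorm_projB; exact: undup_uniq.
Qed.

End Projection.

(** * Information complexity as a count of small weights *)

Section Complexity.
Variables (R : realType) (F : scalar_kind) (X : hilbert R F).
Variables (I : choiceType) (E : I -> X) (w : I -> R).
Hypothesis orthoE : forall i j, dot X (E i) (E j) = (i == j)%:R.
Hypothesis w_gt0 : forall i, 0 < w i.
Implicit Types (x y : X) (S : seq I).

Let wterm_ge0 x i : 0 <= w i * sabs (dot X x (E i)) ^+ 2.
Proof. by rewrite mulr_ge0 ?sqr_ge0// ltW. Qed.

Lemma wsqnorm_fin_num x : (wsqnorm E w x \is a fin_num) = (wsqnorm E w x < +oo)%E.
Proof. by rewrite ge0_fin_numE//; apply: esum_ge0 => i _; rewrite lee_fin. Qed.

Lemma wsqnorm_ge S x : uniq S ->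
  ((\sum_(i <- S) w i * sabs (dot X x (E i)) ^+ 2)%:E <= wsqnorm E w x)%E.
Proof.
move=> uS; apply: esum_ge; exists [set` S]; first by split=> //; exact: finite_seq.
by rewrite -fsbig_seq// sumEFin.
Qed.

Lemma wsqnorm_le x M :
  (forall S, uniq S -> \sum_(i <- S) w i * sabs (dot X x (E i)) ^+ 2 <= M) ->
  (wsqnorm E w x <= M%:E)%E.
Proof.
move=> xM; apply: ub_ereal_sup => _ [A [finA _] <-].
by rewrite fsbig_finite//= sumEFin lee_fin xM.
Qed.

(** All terms are nonnegative, so finiteness of the sum is a bound on its finite partial sums. *)
Lemma wspaceP x : wspace E w x <-> exists M, forall S, uniq S ->
  \sum_(i <- S) w i * sabs (dot X x (E i)) ^+ 2 <= M.
Proof.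
split=> [xw|[M xM]]; last by apply: le_lt_trans (wsqnorm_le xM) _; rewrite ltry.
exists (fine (wsqnorm E w x)) => S uS; rewrite -lee_fin fineK ?wsqnorm_ge//.
by rewrite wsqnorm_fin_num.
Qed.

Lemma wnorm_ge x S : wspace E w x -> uniq S ->
  \sum_(i <- S) w i * sabs (dot X x (E i)) ^+ 2 <= wnorm E w x ^+ 2.
Proof.
move=> xw uS; have x0 : (0 <= wsqnorm E w x)%E by apply: esum_ge0 => i _; rewrite lee_fin.
rewrite sqr_sqrtr ?fine_ge0// -lee_fin fineK ?wsqnorm_ge//.
by rewrite wsqnorm_fin_num.
Qed.

(** Termwise, |c u + v|^2 <= 2 |c|^2 |u|^2 + 2 |v|^2. *)
Lemma wspace_linear c x y : wspace E w x -> wspace E w y -> wspace E w (c *: x + y).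
Proof.
move=> /wspaceP[M xM] /wspaceP[N yN]; apply/wspaceP.
exists (2 * sabs c ^+ 2 * M + 2 * N) => S uS.
apply: (@le_trans _ _ (2 * sabs c ^+ 2 * (\sum_(i <- S) w i * sabs (dot X x (E i)) ^+ 2)
   + 2 * \sum_(i <- S) w i * sabs (dot X y (E i)) ^+ 2)); last first.
  apply: lerD; last by rewrite ler_pM2l ?yN.
  by rewrite ler_wpM2l ?xM// mulr_ge0 ?sqr_ge0.
rewrite !mulr_sumr -big_split /=; apply: ler_sum => i _.
rewrite dotDl dotZl; set u := dot X x _; set v := dot X y _.
rewrite (_ : _ + _ = w i * (2 * (sabs c * sabs u) ^+ 2 + 2 * sabs v ^+ 2)); last by ring.
rewrite ler_pM2l//.
have uv : sabs (c * u + v) <= sabs c * sabs u + sabs v.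
  by rewrite -(sreal_le F) srealD srealM -!normr_sreal -normrM ler_normD.
apply: (@le_trans _ _ ((sabs c * sabs u + sabs v) ^+ 2)).
  by rewrite ler_pXn2r// ?nnegrE ?addr_ge0 ?mulr_ge0 ?sabs_ge0.
rewrite -subr_ge0 (_ : _ - _ = (sabs c * sabs u - sabs v) ^+ 2) ?sqr_ge0//.
by ring.
Qed.

(** Only terms in [S] survive, their weights are at most [W], and Bessel's inequality bounds the
    rest by ||x||^2. *)
Lemma wspace_supported x S W : uniq S -> 0 < W -> (forall i, i \in S -> w i <= W) ->
  (forall i, i \notin S -> dot X x (E i) = 0) ->
  wspace E w x /\ wnorm E w x <= Num.sqrt W * hnorm x.
Proof.
move=> uS W0 SW xS; have xM T : uniq T ->
    \sum_(i <- T) w i * sabs (dot X x (E i)) ^+ 2 <= W * hnorm x ^+ 2.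
  move=> uT; rewrite (bigID (mem S)) /= [X in _ + X]big1 ?addr0 => [|i iS]; last first.
    by rewrite xS// sabs0 expr0n mulr0.
  rewrite -big_filter; set T' := [seq _ <- _ | _].
  have uT' : uniq T' by rewrite filter_uniq.
  apply: (@le_trans _ _ (W * \sum_(i <- T') sabs (dot X x (E i)) ^+ 2)).
    rewrite mulr_sumr big_seq [leRHS]big_seq; apply: ler_sum => i.
    by rewrite mem_filter => /andP[iS _]; rewrite ler_wpM2r ?sqr_ge0 ?SW.
  by rewrite ler_pM2l// (hnorm_proj orthoE x uT') lerDr sqr_ge0.
have xw : wspace E w x by apply/wspaceP; exists (W * hnorm x ^+ 2).
split=> //; have -> : Num.sqrt W * hnorm x = Num.sqrt (W * hnorm x ^+ 2).
  by rewrite sqrtrM ?ltW// sqrtr_sqr ger0_norm// hnorm_ge0.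
apply: ler_wsqrtr; rewrite -lee_fin fineK ?wsqnorm_fin_num//.
exact: wsqnorm_le.
Qed.

Lemma wspace_basis i : wspace E w (E i).
Proof.
have [] // := @wspace_supported (E i) [:: i] (w i) isT (w_gt0 i).
  by move=> j; rewrite inE => /eqP->.
by move=> j; rewrite inE orthoE eq_sym => /negbTE->.
Qed.

Lemma wspace0 : wspace E w (0 : X).
Proof.
have [] // := @wspace_supported 0 [::] 1 isT ltr01.
by move=> i _; rewrite -(subrr (0 : X)) dotBl subrr.
Qed.

Lemma wspaceB x y : wspace E w x -> wspace E w y -> wspace E w (x - y).
Proof. by move=> xw yw; rewrite addrC -scaleN1r; exact: wspace_linear. Qed.

Lemma continuous_functional_coord i :
  continuous_functional E w (fun x => dot X x (E i)).
Proof.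
split=> [c x y _ _|x xw eps eps0]; first by rewrite dotDl dotZl.
(* One term of the weighted norm gives sqrt(w i) |<y - x, E i>| <= [wnorm] (y - x). *)
exists (Num.sqrt (w i) * eps); first by rewrite mulr_gt0// sqrtr_gt0.
move=> y yw yx; have := @wnorm_ge (y - x) [:: i] (wspaceB yw xw) isT.
rewrite big_seq1 dotBl => yx2.
rewrite -(ltr_pM2l (_ : 0 < Num.sqrt (w i))) ?sqrtr_gt0//; apply: le_lt_trans yx.
rewrite -(@ler_pXn2r _ 2)// ?nnegrE ?sqrtr_ge0//.
  by rewrite exprMn sqr_sqrtr// ltW.
by rewrite mulr_ge0 ?sqrtr_ge0 ?sabs_ge0.
Qed.

Lemma continuous_functional0 L : continuous_functional E w L -> L 0 = 0.
Proof.
move=> [Llin _]; have /eqP := Llin 1 0 0 wspace0 wspace0.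
by rewrite scale1r addr0 mul1r -subr_eq0 opprD addNKr oppr_eq0 => /eqP.
Qed.

Lemma continuous_functional_scale L c x : continuous_functional E w L ->
  wspace E w x -> L (c *: x) = c * L x.
Proof.
move=> Lc xw; rewrite -[c *: x]addr0 (Lc.1 _ _ _ xw wspace0).
by rewrite (continuous_functional0 Lc) addr0.
Qed.

(** Both claims go through one induction, because [L] is assumed linear on [wspace] only. *)
Lemma continuous_functional_sum L (J : Type) (r : seq J) (c : J -> scalars R F) f :
  continuous_functional E w L ->
  wspace E w (\sum_(j <- r) c j *: E (f j)) /\
  L (\sum_(j <- r) c j *: E (f j)) = \sum_(j <- r) c j * L (E (f j)).
Proof.
move=> Lc; elim: r => [|j r [rw IH]].
  by rewrite !big_nil; split; [exact: wspace0|exact: continuous_functional0].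
rewrite !big_cons; split; first by apply: wspace_linear => //; exact: wspace_basis.
by rewrite Lc.1 ?IH//; exact: wspace_basis.
Qed.

Section UpperBound.
Hypothesis denseE : closure (linear_span (range E)) = setT.
Variables (S : seq I) (eps : R).
Hypothesis eps_gt0 : 0 < eps.
Hypothesis epsS : forall i, i \notin S -> 1 <= eps ^+ 2 * w i.
Hypothesis uS : uniq S.

(** The squared error is the sum of |<x, E i>|^2 over i outside [S], and there 1 <= eps^2 w i. To
    stay with finite sums, [S] is enlarged by a finite [U] that captures x up to [d], and [d] is
    arbitrary. *)
Lemma proj_error x : wspace E w x -> wnorm E w x <= 1 -> hnorm (x - oproj E S x) <= eps.
Proof.
move=> xw x1; rewrite -(@ler_pXn2r _ 2) ?nnegrE ?hnorm_ge0 ?(ltW eps_gt0)//.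
apply/ler_addgt0Pr => d d0.
have xE : closure (linear_span (range E)) x by rewrite denseE.
have [||T uT xT] := @proj_dense _ _ _ _ E orthoE x (Num.sqrt d) => //.
  by rewrite sqrtr_gt0.
pose U := [seq i <- T | i \notin S].
have uU : uniq U by rewrite filter_uniq.
have uSU : uniq (S ++ U).
  by rewrite cat_uniq uS uU andbT/=; apply/hasPn => i; rewrite mem_filter => /andP[].
have TU : hnorm (x - oproj E (S ++ U) x) ^+ 2 <= d.
  rewrite -[leRHS]sqr_sqrtr ?(ltW d0)// ler_pXn2r ?nnegrE ?hnorm_ge0 ?sqrtr_ge0//.
  apply: le_trans (ltW xT); apply: hnorm_proj_sub => // i iT.
  by rewrite mem_cat mem_filter iT andbT orbN.
have := hnorm_proj orthoE x uS; rewrite (hnorm_proj orthoE x uSU) big_cat /=.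
rewrite addrCA [in RHS]addrC => /addrI <-; rewrite addrC; apply: lerD TU.
apply: (@le_trans _ _ (eps ^+ 2 * \sum_(i <- U) w i * sabs (dot X x (E i)) ^+ 2)).
  rewrite mulr_sumr big_seq [leRHS]big_seq; apply: ler_sum => i.
  by rewrite mem_filter => /andP[iS _]; rewrite mulrA ler_peMl ?sqr_ge0 ?epsS.
rewrite ler_piMr ?sqr_ge0//; apply: le_trans (wnorm_ge xw uU) _.
by rewrite expr_le1// sqrtr_ge0.
Qed.

Lemma minimal_error_le : (minimal_error E w (size S) <= eps%:E)%E.
Proof.
apply: (@le_trans _ _ (ereal_sup [set (hnorm (x - oproj E S x))%:E
    | x in [set x | wspace E w x /\ wnorm E w x <= 1]])).
  apply: ereal_inf_lbound; exists (oproj E S) => //.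
  pose s j := tnth (in_tuple S) j.
  exists (fun j x => dot X x (E (s j))), (fun j => E (s j)); split=> [j|x _].
    exact: continuous_functional_coord.
  by rewrite /oproj big_tnth.
by apply: ub_ereal_sup => _ [x [xw x1] <-]; rewrite lee_fin proj_error.
Qed.

End UpperBound.

Lemma information_complexity_le S eps :
  closure (linear_span (range E)) = setT -> 0 < eps ->
  (forall i, i \notin S -> 1 <= eps ^+ 2 * w i) ->
  (information_complexity E w eps <= (size S)%:R%:E)%E.
Proof.
move=> dE e0 epsS; have := @minimal_error_le dE (undup S) eps e0.
rewrite undup_uniq => /(_ _ isT) errS; rewrite /information_complexity.
have {}errS : (minimal_error E w (size (undup S)) <= eps%:E)%E.
  by apply: errS => i; rewrite mem_undup; exact: epsS.
case: pselect => [h|[]]; last by exists (size (undup S)).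
case: ex_minnP => n _ /(_ _ errS) nS.
by rewrite lee_fin ler_nat (leq_trans nS)// size_undup.
Qed.

(** Fewer functionals than vectors vanish together on some nonzero y in the span of [S]. The
    algorithm sends y to 0, so its error there is the whole norm of y. *)
Lemma minimal_error_ge S n W : uniq S -> (n < size S)%N -> 0 < W ->
  (forall i, i \in S -> w i <= W) ->
  ((Num.sqrt W)^-1%:E <= minimal_error E w n)%E.
Proof.
move=> uS nS W0 SW; apply: le_ereal_inf_tmp => _ [A [L [g [Lc Ag]]] <-].
pose s j := tnth (in_tuple S) j.
(* A row vector in the left kernel of [M] is a coefficient vector of a combination killed by every
   [L j]. *)
pose M := \matrix_(i < size S, j < n) L j (E (s i)).
have : kermx M != 0.
  rewrite -mxrank_eq0 mxrank_ker subn_eq0 -ltnNge.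
  by apply: leq_ltn_trans nS; exact: rank_leq_col.
move=> /rowV0Pn[v /sub_kermxP vM v0].
pose y := \sum_(i < size S) v 0 i *: E (s i).
have Ly j : L j y = 0.
  have [_ ->] := continuous_functional_sum (index_enum _) (v 0) s (Lc j).
  move/matrixP: vM => /(_ 0 j); rewrite !mxE => vMj; rewrite -[RHS]vMj.
  by apply: eq_bigr => i _; rewrite mxE.
have s_inj : injective s by apply/tuple_uniqP.
have ys i : dot X y (E (s i)) = v 0 i.
  rewrite dot_suml (bigD1 i)//= dotZl orthoE eqxx mulr1 big1 ?addr0// => j ji.
  by rewrite dotZl orthoE (inj_eq s_inj) (negbTE ji) mulr0.
have y0 : hnorm y != 0.
  rewrite hnorm_eq0; apply: contra v0 => /eqP y0; apply/eqP/rowP => i.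
  by rewrite mxE -ys y0 -(subrr (0 : X)) dotBl subrr.
have {}y0 : 0 < hnorm y by rewrite lt_def y0 hnorm_ge0.
(* This scaling gives norm 1 / sqrt W, hence weighted norm at most 1. *)
pose r := (Num.sqrt W * hnorm y)^-1.
have r0 : 0 < r by rewrite invr_gt0 mulr_gt0 ?sqrtr_gt0.
have ry : hnorm (sreal F r *: y) = (Num.sqrt W)^-1.
  by rewrite hnorm_scale sabs_sreal ?ltW// /r invfM mulfVK// gt_eqF.
have [|yw y1] := @wspace_supported (sreal F r *: y) S W uS W0 SW.
  move=> i iS; rewrite dotZl dot_suml big1 ?mulr0// => j _.
  rewrite dotZl orthoE; case: eqVneq => [ij|]; last by rewrite mulr0.
  by move: iS; rewrite -ij mem_tnth.
have Ay : A (sreal F r *: y) = 0.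
  rewrite Ag// big1// => j _.
  have [yw' _] := continuous_functional_sum (index_enum _) (v 0) s (Lc j).
  by rewrite (continuous_functional_scale _ (Lc j) yw') Ly mulr0 scale0r.
apply: ereal_sup_ubound; exists (sreal F r *: y); last by rewrite Ay subr0 ry.
split=> //; apply: le_trans y1 _.
by rewrite ry divff// gt_eqF// sqrtr_gt0.
Qed.

(** Turns the strict bounds on finitely many weights into one bound still below eps^-2, so that the
    error bound 1 / sqrt N exceeds [eps] strictly. *)
Lemma exists_upper_bound (T : eqType) (f : T -> R) (r : seq T) M :
  (forall i, i \in r -> f i < M) -> exists2 N, N < M & forall i, i \in r -> f i <= N.
Proof.
elim: r => [_|i r IH rM]; first by exists (M - 1); rewrite ?ltrBlDr ?ltrDl.
have [j jr|N NM rN] := IH; first by rewrite rM// inE jr orbT.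
exists (Num.max (f i) N); first by rewrite gt_max NM rM ?mem_head.
by move=> j; rewrite inE le_max => /orP[/eqP->|/rN->]; rewrite ?lexx ?orbT.
Qed.

Lemma information_complexity_ge S eps : uniq S -> 0 < eps ->
  (forall i, i \in S -> eps ^+ 2 * w i < 1) ->
  ((size S)%:R%:E <= information_complexity E w eps)%E.
Proof.
move=> uS e0 epsS; rewrite /information_complexity.
case: pselect => [h|_]; last by rewrite leey.
case: ex_minnP => n errn _; rewrite lee_fin ler_nat leqNgt; apply/negP => nS.
have [|N NM SN] := @exists_upper_bound _ w S (eps ^- 2).
  by move=> i /epsS; rewrite -[ltRHS](mulfV (lt0r_neq0 (exprn_gt0 2 e0))) ltr_pM2l ?exprn_gt0.
(* [S] is nonempty because n < [size S], and weights are positive. *)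
have N0 : 0 < N.
  case: S nS SN {uS epsS} => // i S _ /(_ i (mem_head _ _)).
  exact: lt_le_trans.
have := le_trans (minimal_error_ge uS nS N0 SN) errn.
apply/negP; rewrite -ltNge lte_fin -[ltLHS]invrK ltf_pV2 ?posrE ?invr_gt0 ?sqrtr_gt0//.
rewrite -(@ltr_pXn2r _ 2)// ?nnegrE ?sqrtr_ge0 ?invr_ge0 ?ltW//.
by rewrite sqr_sqrtr ?ltW// exprVn.
Qed.

End Complexity.

(** * Closed spans and bounded linear maps *)

Section Span.
Variables (R : realType) (F : scalar_kind).
Implicit Types X Y : hilbert R F.

Lemma linear_span_linear X (A : set X) c x y :
  linear_span A x -> linear_span A y -> linear_span A (c *: x + y).
Proof.
move=> [m [a [u [Au ->]]]] [n [b [v [Av ->]]]].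
exists (m + n)%N.
exists (fun i => match fintype.split i with inl j => c * a j | inr j => b j end).
exists (fun i => match fintype.split i with inl j => u j | inr j => v j end).
split=> [i|]; first by case: fintype.split.
rewrite big_split_ord scaler_sumr; congr (_ + _); apply: eq_bigr => i _.
  by rewrite (unsplitK (inl i)) scalerA.
by rewrite (unsplitK (inr i)).
Qed.

Lemma linear_span_closure_linear X (A : set X) c x y :
  closure (linear_span A) x -> closure (linear_span A) y ->
  closure (linear_span A) (c *: x + y).
Proof.
move=> /closure_hnormP Ax /closure_hnormP Ay; apply/closure_hnormP => r r0.
have c0 : 0 < sabs c + 1 by rewrite ltr_wpDl ?sabs_ge0.
have [|x' Ax' xx'] := Ax (r / 2 / (sabs c + 1)); first by rewrite !divr_gt0.
have [|y' Ay' yy'] := Ay (r / 2); first by rewrite divr_gt0.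
exists (c *: x' + y'); first exact: linear_span_linear.
rewrite opprD addrACA -scalerBr (splitr r); apply: le_lt_trans (hnorm_add _ _) _.
apply: ler_ltD yy'; rewrite hnorm_scale.
apply: (@le_trans _ _ ((sabs c + 1) * hnorm (x - x'))).
  by rewrite ler_wpM2r ?hnorm_ge0// lerDl.
by rewrite mulrC -ler_pdivlMr// ltW.
Qed.

Lemma linear_span_closure_sum X (A : set X) n (c : 'I_n -> scalars R F) v :
  (forall i, closure (linear_span A) (v i)) ->
  closure (linear_span A) (\sum_(i < n) c i *: v i).
Proof.
move=> Av; apply: (big_rec (closure (linear_span A))).
  apply: subset_closure; exists 0%N, (fun=> 0), (fun=> 0).
  by split=> [[]//|]; rewrite big_ord0.
by move=> i x _; exact: linear_span_closure_linear.
Qed.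

(** By linearity [G] sends combinations of [A] into the closed span of [B]; by boundedness it sends
    their limits there too. *)
Lemma bounded_linear_dense X Y (A : set X) (B : set Y) (G : X -> Y) (C : R) :
  (forall c x y, G (c *: x + y) = c *: G x + G y) ->
  0 <= C -> (forall x, hnorm (G x) <= C * hnorm x) ->
  closure (linear_span A) = setT ->
  (forall x, A x -> closure (linear_span B) (G x)) ->
  forall x, closure (linear_span B) (G x).
Proof.
move=> Glin C0 GC dA AB x; apply/closure_hnormP => r r0.
have G0 : G 0 = 0.
  have /eqP := Glin 1 0 0; rewrite !scale1r addr0 -subr_eq0 opprD addNKr.
  by rewrite oppr_eq0 => /eqP.
(* [C + 1] replaces [C] as a divisor, since [C] may be 0. *)
have C1 : 0 < C + 1 by rewrite ltr_wpDl.
have : closure (linear_span A) x by rewrite dA.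
move=> /closure_hnormP /(_ (r / 2 / (C + 1))) [|_ [n [c [v [Av ->]]]] xy].
  by rewrite !divr_gt0.
set y := \sum_(_ < _) _ in xy.
have Gy : G y = \sum_(i < n) c i *: G (v i).
  rewrite /y; elim: (index_enum _) => [|i s IH]; first by rewrite !big_nil.
  by rewrite !big_cons Glin IH.
have : closure (linear_span B) (G y).
  by rewrite Gy; apply: linear_span_closure_sum => i; apply: AB; exact: Av.
move=> /closure_hnormP /(_ (r / 2)) [|z Bz yz]; first by rewrite divr_gt0.
exists z => //; rewrite -(subrK (G y) (G x)) -addrA (splitr r).
apply: le_lt_trans (hnorm_add _ _) _; apply: ler_ltD yz.
have <- : G (x - y) = G x - G y.
  by rewrite addrC -scaleN1r Glin scaleN1r addrC.
apply: le_trans (GC _) _; apply: (@le_trans _ _ ((C + 1) * hnorm (x - y))).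
  by rewrite ler_wpM2r ?hnorm_ge0// lerDl.
by rewrite mulrC -ler_pdivlMr// ltW.
Qed.

End Span.

(** * The orthonormal basis of the tensor product *)

Section TensorBasis.
Variables (R : realType) (F : scalar_kind) (X Xs : hilbert R F) (s : nat).
Variables (tau : ('I_s -> X) -> Xs) (e : nat -> X).
Hypothesis htau : hilbert_tensor tau.
Hypothesis he : orthonormal_basis e.

Lemma hnorm_tensor f : hnorm (tau f) = \prod_(j < s) hnorm (f j).
Proof.
apply/eqP; rewrite -(@eqrXn2 _ 2) ?hnorm_ge0//; last first.
  by apply: prodr_ge0 => j _; exact: hnorm_ge0.
apply/eqP/(@sreal_inj _ F); rewrite -dotxx (tensor_dot htau) -prodrXl.
rewrite (big_morph _ (@srealM R F) (@sreal1 R F)).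
by apply: eq_bigr => j _; rewrite dotxx.
Qed.

Lemma tensor_basis_ortho (n n' : {ffun 'I_s -> nat}) :
  dot Xs (tensor_basis e tau n) (tensor_basis e tau n') = (n == n')%:R.
Proof.
rewrite (tensor_dot htau); case: eqVneq => [->|nn'].
  by rewrite big1// => j _; rewrite he.1 eqxx.
have /existsP[j njn'] : [exists j, n j != n' j].
  by apply: contraNT nn' => /existsPn nn'; apply/eqP/ffunP => j; exact/eqP/negPn.
by rewrite (bigD1 j)//= he.1 (negbTE njn') mul0r.
Qed.

(** Elementary tensors have dense span, so it suffices to approximate them; their factors are
    replaced by basis vectors one at a time. *)
Lemma tensor_basis_dense : closure (linear_span (range (tensor_basis e tau))) = setT.
Proof.
set V := closure _; suff tauV f : V (tau f).
  apply/seteqP; split=> // x _.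
  apply: (bounded_linear_dense (G := id) (A := range tau) _ ler01).
  - by [].
  - by move=> y; rewrite mul1r.
  - exact: tensor_dense.
  - by move=> _ [f _ <-]; exact: tauV.
(* Only the first [k] factors are arbitrary: k = 0 is a basis tensor, k = s is any elementary
   tensor. *)
suff H k : forall f, (forall j : 'I_s, (k <= j)%N -> range e (f j)) -> V (tau f).
  by apply: (H s) => j; rewrite leqNgt ltn_ord.
elim: k => [|k IH] {}f fe.
  have /choice[n nf] : forall j, exists n, e n = f j.
    by move=> j; have [n _ <-] := fe j isT; exists n.
  apply: subset_closure; exists 1%N, (fun=> 1), (fun=> tau f); split=> [_|].
    exists [ffun j => n j] => //; congr tau.
    by apply/funext => j; rewrite ffunE nf.
  by rewrite big_ord1 scale1r.
have [ks|sk] := ltnP k s; last first.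
  by apply: IH => j kj; have := ltn_ord j; rewrite ltnNge (leq_trans sk).
(* With the other factors frozen, [G] is linear and bounded by the product of their norms; on basis
   vectors the induction hypothesis applies. *)
pose i := Ordinal ks; pose G x := tau (fun j => if j == i then x else f j).
suff GV x : V (G x).
  rewrite (_ : f = fun j => if j == i then f i else f j); first exact: GV.
  by apply/funext => j; case: eqP => // ->.
apply: (bounded_linear_dense (A := range e) (C := \prod_(j < s | j != i) hnorm (f j))).
- by move=> c y z; rewrite /G (tensor_multilinear htau).
- by apply: prodr_ge0 => j _; exact: hnorm_ge0.
- move=> y; rewrite hnorm_tensor (bigD1 i)//= eqxx mulrC.
  by under eq_bigr => j ji do rewrite (negbTE ji).
- exact: he.2.
move=> _ [n _ <-]; apply: IH => j kj.
case: eqVneq => [_|ji]; first by exists n.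
by apply: fe; rewrite ltn_neqAle kj andbT; apply: contra ji => /eqP kj'; apply/eqP/val_inj.
Qed.

End TensorBasis.

(** * The block index k(n) *)

Section BlockIndex.
Variable m : nat -> nat.
Hypothesis m_gt0 : forall k, (0 < m k)%N.

Lemma block_startS k : block_start m k.+1 = (block_start m k + m k)%N.
Proof. by rewrite /block_start big_ord_recr. Qed.

Lemma leq_block_start k : (k <= block_start m k)%N.
Proof.
elim: k => [//|k IH]; rewrite block_startS -addn1.
exact: leq_add.
Qed.

(** The least k with n < r_{k+1} shows that the default of [xget] is not reached; [.-1] is harmless
    as r_{k+1} > 0. *)
Lemma block_indexP n :
  (block_start m (block_index m n) <= n < block_start m (block_index m n).+1)%N.
Proof.
have b_gt0 k : (0 < block_start m k.+1)%N.
  by apply: leq_trans (leq_block_start k.+1).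
suff [k nk] : exists k, (block_start m k <= n <= (block_start m k.+1).-1)%N.
  have := @xgetI _ 0%N [set k | (block_start m k <= n <= (block_start m k.+1).-1)%N] k nk.
  rewrite -/(block_index m n) /= => /andP[-> kn].
  by rewrite -(prednK (b_gt0 _)) ltnS.
have ex : exists k, (n < block_start m k.+1)%N by exists n; exact: leq_block_start.
case: (ex_minnP ex) => k nk kmin; exists k; rewrite -[(n <= _)%N]ltnS (prednK (b_gt0 _)) nk andbT.
case: k nk kmin => [|k] _ kmin; first by rewrite /block_start big_ord0.
by rewrite leqNgt; apply/negP => /kmin; rewrite ltnn.
Qed.

Lemma block_index_leq n : (block_index m n <= n)%N.
Proof. by apply: leq_trans (leq_block_start _) _; case/andP: (block_indexP n). Qed.

Lemma block_index0 : block_index m 0 = 0%N.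
Proof. by apply/eqP; rewrite -leqn0 block_index_leq. Qed.

Lemma block_index_gt0 n : m 0%N = 1%N -> (0 < n)%N -> (0 < block_index m n)%N.
Proof.
move=> m0 n0; rewrite lt0n; apply/eqP => k0.
have := block_indexP n; rewrite k0 block_startS /block_start big_ord0 m0.
by case: n n0 {k0}.
Qed.

Lemma block_index1 : m 0%N = 1%N -> block_index m 1 = 1%N.
Proof.
by move=> m0; apply/eqP; rewrite eqn_leq block_index_leq block_index_gt0.
Qed.

Lemma block_index1_eq0 : (1 < m 0%N)%N -> block_index m 1 = 0%N.
Proof.
move=> m0; apply/eqP; rewrite -leqn0 leqNgt; apply/negP => k0.
have /andP[+ _] := block_indexP 1; rewrite leqNgt => /negP; apply.
case: (block_index m 1) k0 => // k _; apply: leq_trans m0 _.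
elim: k => [|k IH]; first by rewrite block_startS leq_addl.
by rewrite block_startS (leq_trans IH)// leq_addr.
Qed.

Lemma block_index_bound M n : (forall k, (m k <= M)%N) ->
  (n < M * (block_index m n).+1)%N.
Proof.
move=> mM; have /andP[_] := block_indexP n; move=> /leq_trans; apply.
elim: (block_index m n).+1 => [|k IH]; first by rewrite /block_start big_ord0.
by rewrite block_startS mulnS addnC leq_add.
Qed.

End BlockIndex.

(** * Elementary real estimates *)

Section RealEstimates.
Variable R : realType.
Implicit Types x y : R.

Lemma archi_le0 x y : (forall n, n%:R * x <= y) -> x <= 0.
Proof.
move=> nxy; rewrite leNgt; apply/negP => x0.
have y0 : 0 <= y by have := nxy 0%N; rewrite mul0r.
have := archi_boundP (divr_ge0 y0 (ltW x0)); rewrite ltr_pdivrMr//.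
by apply/negP; rewrite -leNgt.
Qed.

Lemma sum_inv_sqr N : \sum_(n < N) (n.+1%:R ^- 2 : R) <= 2.
Proof.
case: N => [|N]; first by rewrite big_ord0.
(* The sharper bound makes the induction telescope. *)
suff H : \sum_(n < N.+1) (n.+1%:R ^- 2 : R) <= 2 - N.+1%:R^-1.
  by apply: le_trans H _; rewrite gerDl oppr_le0 invr_ge0.
elim: N => [|N IH]; first by rewrite big_ord1 expr1n invr1; lra.
rewrite big_ord_recr /=; apply: le_trans (lerD IH (lexx _)) _.
have N1 : 0 < N.+1%:R :> R by rewrite ltr0n.
have -> : N.+2%:R = N.+1%:R + 1 :> R by rewrite -natr1.
set x := N.+1%:R in N1 *.
have x1 : 0 < x + 1 by rewrite ltr_wpDl// ltW.
have -> : 2 - x^-1 + (x + 1) ^- 2 = 2 - (x + 1)^-1 - x^-1 * (x + 1) ^- 2.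
  by field; rewrite !gt_eqF.
by rewrite gerDl oppr_le0 mulr_ge0// invr_ge0 ?exprn_ge0 ?ltW.
Qed.

(** Each of the d factors q + 1, ..., q + d of the falling factorial is at least q. *)
Lemma bin_ge q d : q%:R ^+ d / d`!%:R <= 'C(q + d, d)%:R :> R.
Proof.
rewrite ler_pdivrMr ?ltr0n ?fact_gt0// -natrX -natrM ler_nat bin_ffact.
elim: d => [|d IH]; first by rewrite expn0 ffactn0.
by rewrite expnS addnS ffactSS leq_mul// leqW// leq_addr.
Qed.

(** Compares growth in q: degree d on the left, degree T on the right. Along q = 2^p the logarithms
    are affine in p up to the estimate 2^p + d <= 2^p (d + 1), and the slopes are compared. *)
Lemma degree_le_of_growth d (C T : R) : 0 < C -> 0 <= T ->
  (forall q, (0 < q)%N -> q%:R ^+ d / d`!%:R <= C * expR (T * (1 + ln (q + d)%:R))) ->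
  d%:R <= T.
Proof.
move=> C0 T0 H; rewrite -subr_le0.
have ln2 : 0 < ln (2 : R) by rewrite ln_gt0// ltr1n.
rewrite -(pmulr_lle0 _ ln2).
apply: (@archi_le0 _ (ln (d`!%:R * C) + T * (1 + ln d.+1%:R))) => p.
have q0 : (0 < 2 ^ p)%N by rewrite expn_gt0.
have := H _ q0; rewrite ler_pdivrMr ?ltr0n ?fact_gt0//.
rewrite mulrC mulrA => {}H.
have lnq : ln (2 ^ p)%:R = p%:R * ln 2 :> R by rewrite natrX lnXn// mulr_natl.
have lnqd : ln (2 ^ p + d)%:R <= p%:R * ln 2 + ln d.+1%:R :> R.
  rewrite -lnq -lnM ?posrE ?ltr0n// ler_ln ?posrE -?natrM ?ltr0n ?addn_gt0 ?muln_gt0 ?q0//.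
  by rewrite ler_nat mulnS leq_add2l leq_pmull.
have {H} : ln ((2 ^ p)%:R ^+ d) <= ln (d`!%:R * C * expR (T * (1 + ln (2 ^ p + d)%:R))).
  rewrite ler_ln// posrE ?exprn_gt0 ?ltr0n// !mulr_gt0 ?expR_gt0 ?ltr0n ?fact_gt0//.
rewrite lnXn ?ltr0n// lnq lnM ?posrE ?mulr_gt0 ?expR_gt0 ?ltr0n ?fact_gt0// expRK.
rewrite -mulr_natl => H.
have := ler_wpM2l T0 lnqd; nra.
Qed.

(** With x = k^beta and beta (p + 1) >= 2, k^2 <= x^(p+1) <= (p+1)! e^x; then n <= M k turns decay
    in k into summable decay in n. *)
Lemma expRN_powR_bound (M : nat) (beta : R) : 0 < beta -> exists2 C : R, 0 < C &
  forall k n : nat, (0 < k)%N -> (n <= M * k)%N -> (0 < n)%N ->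
    expR (- (k%:R `^ beta)) <= C / n%:R ^+ 2.
Proof.
move=> beta0; pose p := Num.bound (2 / beta).
have p2 : 2 <= beta * p.+1%:R.
  rewrite mulrC -ler_pdivrMr// ltW// (lt_trans (archi_boundP _))//.
    by rewrite divr_ge0// ltW.
  by rewrite ltr_nat.
exists (p.+1`!%:R * (M%:R ^+ 2 + 1)); first by rewrite mulr_gt0 ?ltr0n ?fact_gt0 ?ltr_wpDl ?sqr_ge0.
move=> k n k0 nMk n0; set x := k%:R `^ beta.
have k1 : 1 <= k%:R :> R by rewrite ler1n.
have kx : k%:R ^+ 2 <= x ^+ p.+1.
  by rewrite -!powR_mulrn ?powR_ge0// -powRrM ler_powR.
have x0 : 0 <= x by exact: powR_ge0.
have := expR_ge1Dxn p x0 => ex.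
have {}ex : k%:R ^+ 2 <= p.+1`!%:R * expR x.
  rewrite -ler_pdivrMl ?ltr0n ?fact_gt0// mulrC; apply: le_trans ex.
  apply: ler_wpDl => //; rewrite ler_wpM2r// invr_ge0 ler0n//.
have nk : n%:R ^+ 2 <= M%:R ^+ 2 * k%:R ^+ 2 :> R.
  by rewrite -exprMn -natrM ler_pXn2r ?nnegrE// ler_nat.
rewrite expRN ler_pdivlMr ?exprn_gt0 ?ltr0n// mulrC ler_pdivrMr ?expR_gt0//.
apply: le_trans nk _.
have F0 : 0 <= p.+1`!%:R * expR x by rewrite mulr_ge0 ?expR_ge0.
have := ler_wpM2l (sqr_ge0 (M%:R : R)) ex; nra.
Qed.

End RealEstimates.

(** * Lower and upper bounds for the tractability exponent *)

Section Tractability.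
Variables (R : realType) (F : scalar_kind) (H : hilbert R F) (e : nat -> H).
Variables (Hs : nat -> hilbert R F) (tau : forall s : nat, ('I_s -> H) -> Hs s).
Variables (omega : R) (m : nat -> nat) (a b : nat -> R).
Hypothesis he : orthonormal_basis e.
Hypothesis htau : forall s : nat, (0 < s)%N -> hilbert_tensor (tau (s := s)).
Hypothesis homega : 0 < omega < 1.
Hypothesis m_gt0 : forall k, (0 < m k)%N.

Let APP := app_complexity m omega a b e tau.
Let L : R := ln omega^-1.
Let xi (s : nat) (n : 'I_s -> nat) : R :=
  \sum_(j < s) a j * (block_index m (n j))%:R `^ b j.

Lemma log_omega_gt0 : 0 < L.
Proof.
by case/andP: homega => o0 o1; rewrite /L ln_gt0// invf_gt1.
Qed.

Lemma app_weightE s (n : {ffun 'I_s -> nat}) : app_weight m omega a b n = expR (L * xi n).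
Proof.
case/andP: homega => o0 _; rewrite /app_weight /powR gt_eqF//.
by rewrite /L lnV ?posrE// !mulNr mulrC.
Qed.

Lemma app_weight_gt0 s (n : {ffun 'I_s -> nat}) : 0 < app_weight m omega a b n.
Proof. by rewrite app_weightE expR_gt0. Qed.

(** For eps = e^-K the counting criterion eps^2 w < 1 becomes L xi < 2 K. *)
Lemma sqr_app_weightE (K : R) s (n : {ffun 'I_s -> nat}) :
  expR (- K) ^+ 2 * app_weight m omega a b n = expR (L * xi n - 2 * K).
Proof. by rewrite app_weightE -expRM_natl -expRD; congr expR; ring. Qed.

(** Counts indicator functions of d-subsets: entries 1 cost [c] each, entries 0 cost nothing since
    k(0) = 0 and [b j] > 0. *)
Lemma complexity_ge_bin s d (K c : R) : (0 < s)%N ->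
  (forall j, a j * (block_index m 1)%:R `^ b j = c) ->
  (forall j, 0 < b j) -> L * (d%:R * c) < 2 * K ->
  ('C(s, d)%:R%:E <= APP s (expR (- K)))%E.
Proof.
move=> s0 ac b0 cK.
pose v (A : {set 'I_s}) : {ffun 'I_s -> nat} := [ffun j => (j \in A : nat)].
have v_inj : injective v.
  move=> A B /ffunP AB; apply/setP => j; have := AB j; rewrite !ffunE.
  by do 2 case: (_ \in _).
pose D := [set A : {set 'I_s} | #|A| == d]%SET.
have -> : 'C(s, d) = size [seq v A | A <- enum D].
  by rewrite size_map -cardE card_draws card_ord.
apply: information_complexity_ge.
- exact: (tensor_basis_ortho (htau s0) he).
- exact: app_weight_gt0.
- by rewrite map_inj_uniq// enum_uniq.
- exact: expR_gt0.
move=> n /mapP[A]; rewrite mem_enum inE => /eqP Ad ->.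
rewrite sqr_app_weightE -[ltRHS]expR0 ltr_expR subr_lt0; apply: le_lt_trans _ cK.
suff -> : xi (v A) = d%:R * c by [].
rewrite /xi (bigID (mem A)) /= [X in _ + X]big1 ?addr0 => [|j jA]; last first.
  by rewrite ffunE (negbTE jA) block_index0// powR0 ?mulr0// gt_eqF.
under eq_bigr => j jA do rewrite ffunE jA ac.
by rewrite sumr_const Ad mulr_natl.
Qed.

(** [K] is just large enough for the indicators of d-subsets to count. With s = q + d, their number
    grows like q^d and the tractability bound like q^(t (1 + K)). *)
Lemma qpt_bound_degree (t c : R) d : qpt_bound APP t -> 0 < t -> 0 <= c ->
  (forall j, a j * (block_index m 1)%:R `^ b j = c) -> (forall j, 0 < b j) ->
  d%:R <= t * (1 + (L * (d%:R * c) + 1) / 2).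
Proof.
move=> [C C0 tC] t0 c0 ac b0; set K := (_ + 1) / 2.
have Lc0 : 0 <= L * (d%:R * c) by rewrite !mulr_ge0// ltW// log_omega_gt0.
have K0 : 0 < K by rewrite /K divr_gt0// ltr_wpDl.
apply: (@degree_le_of_growth _ d C) => //.
  by rewrite mulr_ge0 ?addr_ge0 ?ltW.
move=> q q0; apply: le_trans (bin_ge _ _ _) _.
have s0 : (0 < q + d)%N by rewrite addn_gt0 q0.
rewrite -lee_fin; apply: (le_trans (@complexity_ge_bin _ _ K c s0 ac b0 _)).
  by rewrite /K; lra.
have := tC (q + d)%N (expR (- K)) s0.
rewrite expR_gt0 -[ltRHS]expR0 ltr_expR oppr_lt0 K0 => /(_ isT) /le_trans; apply.
by rewrite -expRN opprK expRK mulrAC lexx.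
Qed.

(** Here k(1) = 0, so c = 0 and d <= 3 t / 2 would hold for every d. *)
Lemma not_qpt_of_m0_gt1 (t : R) : (forall j, 0 < b j) -> (1 < m 0%N)%N ->
  0 < t -> ~ qpt_bound APP t.
Proof.
move=> b0 m0 t0 tC.
have H0 j : a j * (block_index m 1)%:R `^ b j = 0.
  by rewrite block_index1_eq0// powR0 ?mulr0// gt_eqF.
have /archi_le0 : forall d : nat, d%:R * 1 <= t * (1 + 1 / 2).
  move=> d; have := qpt_bound_degree d tC t0 (lexx 0) H0 b0.
  by rewrite !mulr0 add0r mulr1.
by rewrite ler10.
Qed.

(** Here k(1) = 1, so c = [a 0] and the degree inequality reads d (2 - t [a 0] L) <= 3 t for every
    d. *)
Lemma qpt_bound_ge (t : R) : (forall j, 0 < b j) -> m 0%N = 1%N -> 0 < a 0%N ->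
  (forall j, a j = a 0%N) -> 0 < t -> qpt_bound APP t -> 2 / (a 0%N * L) <= t.
Proof.
move=> b0 m0 a0 aE t0 tC; have L0 := log_omega_gt0.
rewrite ler_pdivrMr ?mulr_gt0// -subr_le0.
apply: (@archi_le0 _ _ (3 * t)) => d.
have ac j : a j * (block_index m 1)%:R `^ b j = a 0%N.
  by rewrite block_index1// powR1 mulr1.
have := qpt_bound_degree d tC t0 (ltW a0) ac b0; rewrite -/L; nra.
Qed.

Hypothesis a_ge : forall j, a 0%N <= a j.
Hypothesis a0_gt0 : 0 < a 0%N.
Hypothesis hm_bounded : exists M : nat, forall k : nat, (m k <= M)%N.
Hypothesis m0 : m 0%N = 1%N.
Variable beta : R.
Hypothesis beta_gt0 : 0 < beta.
Hypothesis b_ge : forall j, beta <= b j.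

Lemma block_expR_bound : exists2 C : R, 0 < C & forall n : nat, (0 < n)%N ->
  expR (- ((block_index m n)%:R `^ beta)) <= C / n%:R ^+ 2.
Proof.
(* The factor 2 comes from n < M (k + 1) <= 2 M k, valid because k >= 1. *)
have [M mM] := hm_bounded; have [C C0 Cb] := expRN_powR_bound (2 * M) beta_gt0.
exists C => // n n0; apply: Cb => //; first exact: block_index_gt0.
have := block_index_bound m_gt0 n mM; have := block_index_gt0 m_gt0 m0 n0; nia.
Qed.

Lemma powR_block_ge n j : (0 < n)%N ->
  1 <= (block_index m n)%:R `^ beta <= (block_index m n)%:R `^ b j.
Proof.
move=> n0; have k1 : 1 <= (block_index m n)%:R :> R.
  by rewrite ler1n block_index_gt0.
by rewrite -{1}(powRr0 (block_index m n)%:R) !ler_powR// ltW.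
Qed.

Lemma xi_ge_term s (n : 'I_s -> nat) i :
  a 0%N * (block_index m (n i))%:R `^ b i <= xi n.
Proof.
rewrite /xi (bigD1 i)//= -[leLHS]addr0; apply: lerD.
  by rewrite ler_wpM2r ?powR_ge0.
apply: sumr_ge0 => j _; rewrite mulr_ge0 ?powR_ge0//.
exact: le_trans (ltW a0_gt0) (a_ge j).
Qed.

(* Markov's inequality: a counted multi-index has [L * xi < 2 * K], so it
   contributes at least 1 to the sum of all [expR (T * (2 * K - L * xi))],
   which factors over the coordinates. *)
Lemma complexity_le_prod s (K T : R) : (0 < s)%N -> 0 < K -> 0 <= T ->
  exists N : nat, (APP s (expR (- K)) <=
    (expR (2 * K * T) * \prod_(j < s) \sum_(i < N.+1)
      expR (- (T * (L * (a j * (block_index m i)%:R `^ b j)))))%:E)%E.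
Proof.
move=> s0 K0 T0; have L0 := log_omega_gt0.
have [C C0 Cb] := block_expR_bound.
(* A single entry beyond [N] already makes the multi-index too heavy: e^(-k^beta) <= C / n^2 <= C /
   n forces L [a 0] k^beta >= 2 K. *)
pose N := Num.bound (C * expR (2 * K / (L * a 0%N))); exists N.
have kN n i : (N < n)%N -> 2 * K <= L * (a 0%N * (block_index m n)%:R `^ b i).
  move=> Nn; have n0 : (0 < n)%N by exact: leq_trans Nn.
  have La : 0 < L * a 0%N by rewrite mulr_gt0.
  have nR : 0 < n%:R :> R by rewrite ltr0n.
  rewrite mulrA [leRHS]mulrC -ler_pdivrMr//.
  have /andP[_] := powR_block_ge i n0; apply: le_trans.
  rewrite -lerN2 -ler_expR; apply: le_trans (Cb n n0) _.
  rewrite expRN ler_pdivrMr ?exprn_gt0// mulrC ler_pdivlMr ?expR_gt0//.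
  apply: (@le_trans _ _ n%:R); last by rewrite expr2 ler_peMl ?ler1n// ltW.
  apply: ltW; apply: lt_le_trans (archi_boundP _) _.
    by rewrite mulr_ge0 ?expR_ge0// ltW.
  by rewrite ler_nat ltnW.
pose D := [set f : {ffun 'I_s -> 'I_N.+1} | L * xi (fun j => f j) < 2 * K]%SET.
pose v (f : {ffun 'I_s -> 'I_N.+1}) : {ffun 'I_s -> nat} := [ffun j => f j : nat].
apply: (@le_trans _ _ (size [seq v f | f <- enum D])%:R%:E).
  apply: information_complexity_le.
  - exact: (tensor_basis_ortho (htau s0) he).
  - exact: app_weight_gt0.
  - exact: (tensor_basis_dense (htau s0) he).
  - exact: expR_gt0.
  move=> n; apply: contraNT; rewrite -ltNge sqr_app_weightE -[ltRHS]expR0 ltr_expR subr_lt0 => nK.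
  have nN j : (n j < N.+1)%N.
    rewrite ltnS leqNgt; apply/negP => /(@kN _ j) Kn.
    move: nK; rewrite ltNge; apply/negP/negPn; apply: le_trans Kn _.
    by rewrite ler_pM2l// xi_ge_term.
  pose f : {ffun 'I_s -> 'I_N.+1} := [ffun j => inord (n j)].
  have fn : n = v f by apply/ffunP => j; rewrite !ffunE inordK.
  have xif : xi (fun j => f j) = xi n by apply: eq_bigr => j _; rewrite ffunE inordK.
  by rewrite fn map_f// mem_enum inE xif.
rewrite lee_fin size_map -cardE -sum1_card natr_sum.
(* The product of sums expands into a sum over all [f]; the terms outside [D] are nonnegative and
   are dropped. *)
rewrite bigA_distr_bigA mulr_sumr /= [leRHS](bigID (mem D)) /=.
apply: ler_wpDr.
  by apply: sumr_ge0 => f _; rewrite mulr_ge0 ?expR_ge0// prodr_ge0// => j _; exact: expR_ge0.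
apply: ler_sum => f; rewrite inE => fK.
rewrite -expR_sum -expRD -[leLHS]expR0 ler_expR.
rewrite sumrN -!mulr_sumr -/(xi (fun j => f j)).
have := ler_wpM2l T0 (ltW fK); rewrite /xi; lra.
Qed.

(** Index 0 contributes the 1. Elsewhere x = k^beta >= 1, so (1 + l) x >= x + l: the share x makes
    the series converge uniformly in j, the share l gives the factor e^-l. *)
Lemma sum_block_expR : exists2 D : R, 0 <= D & forall (N j : nat) (l T : R),
  0 <= l -> 1 + l <= T * (L * a 0%N) ->
  \sum_(i < N.+1) expR (- (T * (L * (a j * (block_index m i)%:R `^ b j)))) <=
  1 + D * expR (- l).
Proof.
have L0 := log_omega_gt0.
have [C C0 Cb] := block_expR_bound; exists (C * 2) => [|N j l T l0 lT].
  by rewrite mulr_ge0 ?ltW.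
rewrite big_ord_recl block_index0// powR0 ?gt_eqF ?(lt_le_trans beta_gt0)//.
rewrite !mulr0 oppr0 expR0 lerD2l.
apply: (@le_trans _ _ (\sum_(i < N) C * (i.+1%:R ^- 2) * expR (- l))); last first.
  by rewrite -mulr_suml -mulr_sumr ler_wpM2r ?expR_ge0// ler_pM2l// sum_inv_sqr.
apply: ler_sum => i _; rewrite lift0.
have /andP[x1 xy] := @powR_block_ge i.+1 j isT.
apply: (@le_trans _ _ (expR (- (block_index m i.+1)%:R `^ beta) * expR (- l))); last first.
  by rewrite ler_wpM2r ?expR_ge0// Cb.
rewrite -expRD ler_expR -opprD lerN2.
set x := _ `^ beta in x1 xy *; set y := _ `^ b j in xy *.
have T0 : 0 < T.
  by rewrite -(pmulr_lgt0 _ (mulr_gt0 L0 a0_gt0)); apply: lt_le_trans lT; rewrite ltr_wpDr.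
apply: (@le_trans _ _ (T * (L * a 0%N) * y)); last first.
  by rewrite -mulrA ler_pM2l// -mulrA ler_pM2l// ler_wpM2r// (le_trans _ xy)// (le_trans _ x1).
apply: (@le_trans _ _ ((1 + l) * x)); first by nra.
apply: ler_pM => //; first by rewrite addr_ge0.
by rewrite (le_trans _ x1).
Qed.

Lemma qpt_bound_le : qpt_bound APP (2 / (a 0%N * L)).
Proof.
have L0 := log_omega_gt0; have [D D0 Db] := sum_block_expR.
exists (expR D); first exact: expR_gt0.
move=> s eps s0 /andP[eps0 eps1].
set K := ln eps^-1; have epsE : eps = expR (- K) by rewrite /K lnV ?posrE// opprK lnK.
have K0 : 0 < K by rewrite /K ln_gt0// invf_gt1.
have lns : 0 <= ln (s%:R : R) by rewrite ln_ge0// ler1n.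
(* Then T L [a 0] = 1 + ln s, so l = ln s is allowed and each factor is at most 1 + D / s <= e^(D /
   s). *)
pose T := (1 + ln s%:R) / (L * a 0%N).
have La : 0 < L * a 0%N by rewrite mulr_gt0.
have T0 : 0 <= T by rewrite divr_ge0 ?addr_ge0// ltW.
have [N] := complexity_le_prod s0 K0 T0; rewrite -epsE => /le_trans; apply.
rewrite lee_fin mulrC; apply: ler_pM; rewrite ?expR_ge0//.
- by apply: prodr_ge0 => j _; apply: sumr_ge0 => i _; exact: expR_ge0.
- apply: (@le_trans _ _ (\prod_(j < s) expR (D / s%:R))).
    apply: ler_prod => j _; rewrite sumr_ge0/= => [|i _]; last exact: expR_ge0.
    apply: le_trans (expR_ge1Dx _); apply: le_trans (Db N j (ln s%:R) T lns _) _.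
      by rewrite /T divfK// gt_eqF.
    by rewrite expRN lnK ?posrE ?ltr0n.
  rewrite prodr_const card_ord -expRM_natl mulrC divfK//.
  by rewrite pnatr_eq0 -lt0n.
- rewrite ler_expR /T [a 0%N * L]mulrC.
  have -> : 2 * K * ((1 + ln s%:R) / (L * a 0%N)) = 2 / (L * a 0%N) * (1 + ln s%:R) * K.
    by field; rewrite !gt_eqF.
  rewrite ler_wpM2l ?lerDr// mulr_ge0 ?addr_ge0// divr_ge0// ltW//.
Qed.

End Tractability.

Unset Implicit Arguments.
Set Strict Implicit.
Set Printing Implicit Defensive.

Theorem theorem4 (R : realType) (F : scalar_kind)
    (H : hilbert R F) (e : nat -> H)
    (Hs : nat -> hilbert R F) (tau : forall s : nat, ('I_s -> H) -> Hs s)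
    (omega : R) (m : nat -> nat) (a b : nat -> R)
    (he : orthonormal_basis e)
    (htau : forall s : nat, (0 < s)%N -> hilbert_tensor (tau s))
    (homega : 0 < omega < 1)
    (hm_pos : forall k : nat, (0 < m k)%N)
    (hm_bounded : exists M : nat, forall k : nat, (m k <= M)%N)
    (ha_pos : 0 < a 0%N)
    (ha_mono : forall j : nat, a j <= a j.+1)
    (hb_pos : forall j : nat, 0 < b j)
    (hb_inf : 0 < inf (range b)) :
  let APP := app_complexity m omega a b e tau in
  let bound := 2 / (a 0%N * ln omega^-1) in
  (QPT APP <-> m 0%N = 1%N) /\
  (m 0%N = 1%N ->
     (qpt_exponent APP <= bound%:E)%E /\
     ((forall j : nat, a j = a 0%N) -> (forall j : nat, b j = b 0%N) ->
        qpt_exponent APP = bound%:E)).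
Proof.
move=> APP bound.
have bound0 : 0 < bound by rewrite divr_gt0// mulr_gt0// log_omega_gt0.
have a_ge j : a 0%N <= a j by elim: j => // j /le_trans; apply.
(* The infimum of [b] serves as the common exponent [beta]. *)
have b_ge j : inf (range b) <= b j.
  by apply: ge_inf; [exists 0 => _ [i _ <-]; exact: ltW|exists j].
have qpt_le : m 0%N = 1%N -> qpt_bound APP bound.
  by move=> m0; exact: (qpt_bound_le he htau homega hm_pos a_ge ha_pos hm_bounded m0 hb_inf b_ge).
have exp_le : m 0%N = 1%N -> (qpt_exponent APP <= bound%:E)%E.
  by move=> m0; apply: ereal_inf_lbound; exists bound => //; split=> //; exact: qpt_le.
split.
  split=> [[t t0 tC]|m0]; last by exists bound => //; exact: qpt_le.
  apply/eqP; rewrite eqn_leq hm_pos andbT leqNgt; apply/negP => m1.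
  exact: (not_qpt_of_m0_gt1 he htau homega hm_pos hb_pos m1 t0 tC).
move=> m0; split; first exact: exp_le.
move=> aE _; apply/eqP; rewrite eq_le exp_le//=.
apply: le_ereal_inf_tmp => _ [t [t0 tC] <-]; rewrite lee_fin.
exact: (qpt_bound_ge he htau homega hm_pos hb_pos m0 ha_pos aE t0 tC).
Qed.
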